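(* Let $n\in\mathbb{N}$. Let $\hat{P}(n)$ be the set of all partitions of $n$ with parts of size at most $n-2$, that is, of all lists $\sigma=(\sigma_1,\dots,\sigma_f)$ of non-negative integers with $\sigma_1+\dots+\sigma_f=n$ and $\sigma_i\le n-2$ for every $i$, and let $\binom{n}{\sigma}=\frac{n!}{\sigma_1!\,\sigma_2!\cdots\sigma_f!}$. Then the greatest common divisor $\gcd_{\sigma\in\hat{P}(n)}\binom{n}{\sigma}$ is given as follows: (1) if $n=p^s$ for some prime $p$ and integer $s\ge 1$, and $n$ is not of the form $q^t+1$ with $q$ prime and $t\ge 1$, then it equals $p$; (2) if $n=q^t+1$ for some prime $q$ and integer $t\ge 1$, and $n$ is not of the form $p^s$ with $p$ prime and $s\ge 1$, then it equals $q$; (3) if $n=p^s$ and $n=q^t+1$ for some primes $p,q$ and integers $s,t\ge 1$, then it equals $p\cdot q$; (4) otherwise, it equals $1$.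
   Context: A partition of $n\in\mathbb{N}$ is a list of non-negative integers (called parts) that sum to $n$. For a partition $\sigma=(\sigma_1,\dots,\sigma_f)$ of $n$, $\binom{n}{\sigma}=\binom{n}{\sigma_1,\dots,\sigma_f}$ is the multinomial coefficient, i.e. the coefficient of $x_1^{\sigma_1}\cdots x_f^{\sigma_f}$ in $(x_1+\dots+x_f)^n$. The letters $p$ and $q$ denote prime numbers. The gcd is the greatest common divisor of all the integers $\binom{n}{\sigma}$ as $\sigma$ ranges over $\hat{P}(n)$.
   Formalization: The formal theorem assumes that the set of partitions of n with parts at most n-2 is nonempty; this excludes exactly n=1 and n=2, where the gcd of the empty family is 0 or undefined, not the claimed 1 or 2. *)

(* Defs.v *)
(* Libraries: Mathematical Components. *)
From mathcomp Require Import all_boot.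

Set Implicit Arguments.
Unset Strict Implicit.
Unset Printing Implicit Defensive.

(* Lists of any length, zero parts allowed.  The bound i <= n - 2 on the parts
   is written i + 2 <= n, so that the subtraction is not truncated. *)
Definition Phat (n : nat) : pred (seq nat) :=
  [pred s : seq nat | (sumn s == n) && all (fun i => i + 2 <= n) s].

Definition multinomial (n : nat) (s : seq nat) : nat :=
  n`! %/ \prod_(i <- s) i`!.

(* The division in [multinomial] is exact on the partitions of n. *)
Lemma multinomial_fact (n : nat) (s : seq nat) :
  sumn s = n -> multinomial n s * \prod_(i <- s) i`! = n`!.
Proof.
move=> <-; rewrite divnK //.
elim: s => [|i s IHs]; first by rewrite big_nil.
rewrite big_cons /= -(bin_fact (leq_addr (sumn s) i)) addKn dvdn_mull //.
by rewrite dvdn_pmul2l ?fact_gt0.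
Qed.

(* The family may be infinite.  For an empty family g = 0. *)
Definition is_gcd (I : Type) (P : pred I) (F : I -> nat) (g : nat) : Prop :=
  (forall i, P i -> g %| F i) /\
  (forall d, (forall i, P i -> d %| F i) -> d %| g).

Definition prime_power_of (p n : nat) : Prop :=
  prime p /\ exists s, 1 <= s /\ n = p ^ s.

Definition prime_power_plus1_of (q n : nat) : Prop :=
  prime q /\ exists t, 1 <= t /\ n = q ^ t + 1.

(* Main.v *)
Require Import Defs.
From mathcomp Require Import all_boot.

(** Write A m for the prime p when m is a power p ^ s with s >= 1, and A m = 1
    for every other m (so A = exp o Lambda, with Lambda the von Mangoldt
    function).  All four cases of the theorem say that the gcd is
    A n * A n.-1.

    This number divides every coefficient.  Both divisibilities come from
      [multinomial n s * i = n * multinomial n.-1 s'],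
    where i is a positive part of s and s' is s with i lowered by one.
    If n is a power of p, then n divides the left side; were the coefficient
    prime to p, n would divide the part i < n.  If n.-1 is a power of q,
    not every part is a multiple of q, as q does not divide n; for i prime to q,
    the parts of s' are smaller than n.-1, so q divides the right side by the
    first case.  The two factors are coprime, since n and n.-1 are.

    Nothing larger does.  For n > 2 (the other case is n = 0), a common divisor
    d divides the coefficient n * n.-1 of (n - 2, 1, 1), so only the primes r
    dividing n or n.-1 matter.  If N is positive and r ^ b %| N, then the
    valuation of 'C(N, r ^ b) at r is that of N minus b ([logn_bin_pfactor]).
    Taking r ^ b to be the r-part of N when this is not N itself, and N / r
    otherwise, gives a binomial coefficient of N whose valuation at r is 0,
    respectively 1; when N = r, its lower index is 1 and n * n.-1 serves
    instead.  With N = n it bounds the valuation of d for r dividing n.  With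
    N = n.-1 it does so for r dividing n.-1, because
      [n * 'C(n.-1, k) = (n - k) * 'C(n, k)]
    and r divides neither n nor n - k when it divides n.-1 and k. *)

Set Implicit Arguments.
Unset Strict Implicit.
Unset Printing Implicit Defensive.

(** * Divisibility of multinomial coefficients *)

Lemma perm_multinomial n s1 s2 :
  perm_eq s1 s2 -> multinomial n s1 = multinomial n s2.
Proof. by rewrite /multinomial => /(perm_big s2)->. Qed.

Lemma multinomial_absorb n i s : i.+1 + sumn s = n ->
  multinomial n (i.+1 :: s) * i.+1 = n * multinomial n.-1 (i :: s).
Proof.
move=> def_n; have def_n1: sumn (i :: s) = n.-1 by rewrite -def_n.
have prod_gt0: 0 < \prod_(j <- i :: s) j`!.
  by apply: prodn_gt0 => j; apply: fact_gt0.
apply/eqP; rewrite -(eqn_pmul2r prod_gt0) -!mulnA (multinomial_fact def_n1).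
rewrite big_cons [i.+1 * _]mulnA -factS.
have := @multinomial_fact n (i.+1 :: s) def_n.
by rewrite big_cons -def_n => ->; rewrite addSn factS.
Qed.

(** If p did not divide the coefficient, the power n of p, which divides the
    coefficient times a positive part i, would divide i < n. *)
Lemma prime_dvd_multinomial p n s : prime p -> p.-nat n -> sumn s = n ->
  all (fun i => i < n) s -> p %| multinomial n s.
Proof.
move=> p_pr p_n sum_s /allP lt_s.
have n_gt0: 0 < n by case/andP: p_n.
have /hasP[i s_i i_gt0]: has (leq 1) s.
  apply: contraLR n_gt0 => /hasPn s0; rewrite -sum_s -eqn0Ngt sumnE.
  by rewrite big_seq big1 // => i /s0; rewrite -eqn0Ngt => /eqP.
have def_s := perm_to_rem s_i; have := lt_s i s_i.
move: sum_s; rewrite (perm_sumn def_s) (perm_multinomial n def_s).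
case: i i_gt0 {s_i def_s} => // i _ sum_s; apply: contraTT => p_ndv.
have co_n: coprime n (multinomial n (i.+1 :: rem i.+1 s)).
  by apply: pnat_coprime p_n _; rewrite p'natE.
rewrite -leqNgt dvdn_leq // -(Gauss_dvdr _ co_n) multinomial_absorb //.
exact: dvdn_mulr.
Qed.

(** Lowering by one a part prime to q reduces this to the previous lemma, at
    the power n.-1 of q. *)
Lemma prime_dvd_multinomial_pred q n s : prime q -> 2 < n -> q.-nat n.-1 ->
  sumn s = n -> all (fun i => i < n.-1) s -> q %| multinomial n s.
Proof.
move=> q_pr n_gt2 q_n1 sum_s /allP lt_s.
have q_dv: q %| n.-1.
  rewrite -[_ %| _]negbK -p'natE //; apply: contraTN n_gt2 => q'_n1.
  have := pnat_coprime q_n1 q'_n1; rewrite /coprime gcdnn => /eqP.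
  by case: (n) => // m /= ->.
have q_ndv: ~~ (q %| n).
  apply: contraL q_dv => q_n; rewrite -prime_coprime //.
  by apply: coprime_dvdl q_n (coprimenP _); apply: ltn_trans n_gt2.
have /hasP[i s_i q_ndv_i]: has (fun i => ~~ (q %| i)) s.
  apply: contraR q_ndv => /hasPn s0; rewrite -sum_s sumnE big_seq.
  by apply: dvdn_sum => i /s0; rewrite negbK.
have def_s := perm_to_rem s_i; rewrite (perm_multinomial n def_s).
case: i q_ndv_i s_i def_s => [|i]; first by rewrite dvdn0.
move=> q_ndv_i s_i def_s; rewrite (perm_sumn def_s) in sum_s.
have co_q: coprime q i.+1 by rewrite prime_coprime.
rewrite -(Gauss_dvdl _ co_q) multinomial_absorb // dvdn_mull //.
apply: prime_dvd_multinomial => //=; first by rewrite -[in RHS]sum_s.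
rewrite (ltnW (lt_s _ s_i)); apply/allP => j /mem_rem; exact: lt_s.
Qed.

(** * Valuations of binomial coefficients *)

Lemma logn_subl_small r b N i : prime r -> r ^ b %| N -> 0 < N ->
  0 < i < r ^ b -> logn r (N - i) = logn r i.
Proof.
move=> r_pr dvN N_gt0 /andP[i_gt0 lt_i].
have lt_iN: i < N by apply: leq_trans lt_i (dvdn_leq N_gt0 dvN).
have Ni_gt0: 0 < N - i by rewrite subn_gt0.
have dv_eq e : e <= b -> (r ^ e %| N - i) = (r ^ e %| i).
  move=> le_eb; rewrite dvdn_subr ?(ltnW lt_iN) //.
  by rewrite (dvdn_trans _ dvN) ?dvdn_exp2l.
have lt_vb: logn r i < b.
  rewrite -(ltn_exp2l _ _ (prime_gt1 r_pr)); apply: leq_ltn_trans lt_i.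
  by rewrite dvdn_leq ?pfactor_dvdnn.
apply/eqP; rewrite eqn_leq; apply/andP; split; last first.
  by rewrite -pfactor_dvdn // dv_eq ?pfactor_dvdnn // ltnW.
by rewrite leqNgt -(pfactor_dvdn _ r_pr Ni_gt0) dv_eq // pfactor_dvdn // ltnn.
Qed.

(** In the quotient form of 'C(N.-1, j), the factors N - i and i for 0 < i <= j
    have the same valuation. *)
Lemma logn_bin_pred_small r b N j : prime r -> r ^ b %| N -> 0 < N ->
  j < r ^ b -> logn r 'C(N.-1, j) = 0.
Proof.
move=> r_pr dvN N_gt0; have le_bN := dvdn_leq N_gt0 dvN.
elim: j => [|j IHj] lt_j; first by rewrite bin0 logn1.
have lt_jN := leq_trans lt_j le_bN.
have binP k : k < N -> 0 < 'C(N.-1, k).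
  by move=> lt_kN; rewrite bin_gt0 -ltnS prednK.
have subE: N.-1 - j = N - j.+1 by rewrite -(subn1 N) -subnDA add1n.
have Nj_gt0: 0 < N - j.+1 by rewrite subn_gt0.
have := congr1 (logn r) (mul_bin_left N.-1 j); rewrite subE.
rewrite (lognM r (ltn0Sn j)) ?binP // (lognM r Nj_gt0) ?binP ?(ltnW lt_jN) //.
rewrite (logn_subl_small r_pr dvN) // (IHj (ltnW lt_j)) => /eqP.
by rewrite eqn_add2l => /eqP.
Qed.

Lemma logn_bin_pfactor r b N : prime r -> r ^ b %| N -> 0 < N ->
  logn r 'C(N, r ^ b) = logn r N - b.
Proof.
move=> r_pr dvN N_gt0; have rb_gt0: 0 < r ^ b by rewrite expn_gt0 prime_gt0.
have le_bN := dvdn_leq N_gt0 dvN.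
have lt_k1: (r ^ b).-1 < r ^ b by rewrite prednK.
have bin1_gt0: 0 < 'C(N.-1, (r ^ b).-1).
  by rewrite bin_gt0 -ltnS (prednK N_gt0) (leq_trans lt_k1).
have := congr1 (logn r) (mul_bin_diag N (r ^ b).-1); rewrite (prednK rb_gt0).
rewrite (lognM r N_gt0 bin1_gt0) (lognM r rb_gt0) ?bin_gt0 // pfactorK //.
by rewrite (logn_bin_pred_small r_pr dvN) // addn0 => ->; rewrite addKn.
Qed.

(** The witness is the r-part of N, or N / r when N is a power of r.  For N = r
    the latter would be 1. *)
Lemma exists_bin_logn r N : prime r -> 0 < N -> r %| N -> N != r ->
  exists k, [/\ r %| k, 2 <= k, k + 2 <= N & logn r 'C(N, k) = r.-nat N].
Proof.
move=> r_pr N_gt0 r_N neq_Nr; pose a := logn r N.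
have a_gt0: 0 < a by rewrite -pfactor_dvdn.
have a_gt_nat: r.-nat N < a.
  case: (boolP (r.-nat N)) => // r_nat; rewrite ltn_neqAle a_gt0 andbT.
  apply: contraNneq neq_Nr => a1.
  by rewrite -(part_pnat_id r_nat) p_part -/a -a1.
pose b := a - r.-nat N; have b_gt0: 0 < b by rewrite subn_gt0.
have dvN: r ^ b %| N by rewrite pfactor_dvdn // leq_subr.
have r_k: r %| r ^ b by rewrite dvdn_exp.
have k_gt1: 1 < r ^ b by rewrite -(exp1n b) ltn_exp2r ?prime_gt1.
exists (r ^ b); split=> //; last by rewrite logn_bin_pfactor // subKn // ltnW.
case/dvdnP: (dvN) => -[|[|c]] defN; first by rewrite defN in N_gt0.
  (* N = r ^ b would make N a power of r, and then b < a = b. *)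
  have r_nat: r.-nat N by rewrite defN mul1n pnatX pnat_id.
  have: b < a by rewrite ltn_subrL r_nat.
  by rewrite /a defN mul1n pfactorK // ltnn.
by rewrite defN !mulSn leq_add2l (leq_trans k_gt1) ?leq_addr.
Qed.

(** * The common divisors *)

Section CommonDivisor.

Variables n d : nat.
Hypothesis n_gt2 : 2 < n.
Hypothesis d_dvd : forall s, Phat n s -> d %| multinomial n s.

Let n_gt0 : 0 < n. Proof. exact: ltn_trans n_gt2. Qed.

Lemma common_divisor_dvd_bin k : 2 <= k -> k + 2 <= n -> d %| 'C(n, k).
Proof.
move=> k_ge2 k_le; have le_kn: k <= n by rewrite (leq_trans _ k_le) ?leq_addr.
have sum_s: sumn [:: k; n - k] = n by rewrite /= addn0 subnKC.
have <-: multinomial n [:: k; n - k] = 'C(n, k).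
  apply/eqP; rewrite -(@eqn_pmul2r (k`! * (n - k)`!)) ?muln_gt0 ?fact_gt0 //.
  rewrite bin_fact // -(multinomial_fact sum_s).
  by rewrite !big_cons big_nil muln1.
apply: d_dvd; rewrite /Phat inE sum_s eqxx /= k_le andbT.
by rewrite -[leqRHS](subnK le_kn) leq_add2l.
Qed.

Lemma common_divisor_dvd_pronic : d %| n * n.-1.
Proof.
case: (n) n_gt2 d_dvd => [|[|[|m]]] // _ dvd_d; rewrite /=.
have sum_s: sumn [:: m.+1; 1; 1] = m.+3 by rewrite /= addn2.
have <-: multinomial m.+3 [:: m.+1; 1; 1] = m.+3 * m.+2.
  apply/eqP; rewrite -(@eqn_pmul2r (m.+1)`!) ?fact_gt0 // -mulnA -!factS.
  by rewrite -(multinomial_fact sum_s) !big_cons big_nil !muln1.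
by apply: dvd_d; rewrite /Phat inE sum_s eqxx /= addn2 leqnn.
Qed.

Lemma common_divisor_gt0 : 0 < d.
Proof.
apply: dvdn_gt0 common_divisor_dvd_pronic.
by rewrite muln_gt0 n_gt0 -ltnS prednK // ltnW.
Qed.

Lemma logn_common_divisor r : prime r ->
  logn r d <= r.-nat n + r.-nat n.-1.
Proof.
move=> r_pr; have n1_gt0: 0 < n.-1 by rewrite -ltnS prednK // ltnW.
have pronic_gt0: 0 < n * n.-1 by rewrite muln_gt0 n_gt0.
have le_pronic := dvdn_leq_log r pronic_gt0 common_divisor_dvd_pronic.
have le_bin k : 2 <= k -> k + 2 <= n -> logn r d <= logn r 'C(n, k).
  move=> k_ge2 k_le; apply: dvdn_leq_log; last exact: common_divisor_dvd_bin.
  by rewrite bin_gt0 (leq_trans _ k_le) ?leq_addr.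
have co_n := coprimenP n_gt0; rewrite lognM // in le_pronic.
have [r_n | r'_n] := boolP (r %| n).
  have n1_0: logn r n.-1 = 0 by rewrite logn_coprime // (coprime_dvdl r_n).
  apply: leq_trans (leq_addr _ _).
  have [n_r | neq_nr] := eqVneq n r.
    (* Here the binomial coefficient of valuation 1 would be 'C(n, 1), whose
       part n.-1 is too large; n * n.-1 has valuation 1 as well. *)
    apply: leq_trans le_pronic _.
    by rewrite n1_0 addn0 n_r logn_prime // eqxx pnat_id.
  have [k [_ k_ge2 k_le <-]] := exists_bin_logn r_pr n_gt0 r_n neq_nr.
  exact: le_bin.
have n_0: logn r n = 0 by rewrite logn_coprime // prime_coprime.
apply: leq_trans (leq_addl _ _).
have [r_n1 | r'_n1] := boolP (r %| n.-1); last first.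
  apply: leq_trans le_pronic _.
  by rewrite n_0 logn_coprime // prime_coprime.
have [n1_r | neq_n1r] := eqVneq n.-1 r.
  apply: leq_trans le_pronic _.
  by rewrite n_0 n1_r logn_prime // eqxx pnat_id.
have [k [r_k k_ge2 k_le <-]] := exists_bin_logn r_pr n1_gt0 r_n1 neq_n1r.
have k_len: k + 2 <= n by apply: leq_trans k_le (leq_pred n).
have le_kn1: k <= n.-1 by rewrite (leq_trans _ k_le) ?leq_addr.
have lt_kn: k < n by rewrite -(prednK n_gt0) ltnS.
apply: leq_trans (le_bin k k_ge2 k_len) _.
(* Modulo r both n and n - k are 1, so 'C(n, k) and 'C(n.-1, k) have the same
   valuation. *)
have r'_nk: ~~ (r %| n - k) by rewrite dvdn_subl // ltnW.
have co_nk: coprime r (n - k) by rewrite prime_coprime.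
have co_rn: coprime r n by rewrite prime_coprime.
by rewrite -(logn_Gauss _ co_nk) -mul_bin_down (logn_Gauss _ co_rn).
Qed.

End CommonDivisor.

(** * The gcd as a product of two von Mangoldt factors *)

(** The exponential of the von Mangoldt function.  A prime power is recognised
    by its least prime factor being its only one. *)
Definition exp_mangoldt m := if (pdiv m).-nat m then pdiv m else 1.

Lemma exp_mangoldt_pow p m : prime_power_of p m -> exp_mangoldt m = p.
Proof.
case=> p_pr [[|s] [// _ ->]]; rewrite /exp_mangoldt pdiv_pfactor //.
by rewrite pnatX pnat_id.
Qed.

Lemma exp_mangoldt_npow m :
  ~ (exists p, prime_power_of p m) -> exp_mangoldt m = 1.
Proof.
rewrite /exp_mangoldt; case: ifP => // p_m no_pow.
have [m_gt1 | m_le1] := ltnP 1 m; last by case: (m) m_le1 => [|[|]].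
case: no_pow; exists (pdiv m); split; first exact: pdiv_prime.
by have [[|s] def_m] := p_natP p_m; [rewrite def_m in m_gt1 | exists s.+1].
Qed.

Lemma prime_power_plus1E q n : 0 < n ->
  prime_power_plus1_of q n <-> prime_power_of q n.-1.
Proof.
move=> n_gt0; split=> -[q_pr [t [t_gt0 def_n]]]; split=> //; exists t.
  by rewrite def_n addn1.
by rewrite -def_n addn1 prednK.
Qed.

Lemma exp_mangoldt_dvd m : exp_mangoldt m %| m.
Proof. by rewrite /exp_mangoldt; case: ifP => _; rewrite ?pdiv_dvd ?dvd1n. Qed.

Lemma logn_exp_mangoldt r m : prime r -> 1 < m ->
  logn r (exp_mangoldt m) = r.-nat m.
Proof.
move=> r_pr m_gt1; have p_pr := pdiv_prime m_gt1; rewrite /exp_mangoldt.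
have m_gt0 := ltnW m_gt1.
have nat_eq: r.-nat m -> pdiv m = r.
  move=> r_m; apply/eqP.
  by apply: pnatPpi r_m _; rewrite pi_pdiv.
case: ifP => p_m; last first.
  by rewrite logn1; case r_m: (r.-nat m) => //; rewrite (nat_eq r_m) r_m in p_m.
rewrite logn_prime //; congr nat_of_bool; apply/eqP/idP => [-> // | r_m].
by rewrite (nat_eq r_m).
Qed.

Lemma exp_mangoldt_gt0 m : 0 < exp_mangoldt m.
Proof. by rewrite /exp_mangoldt; case: ifP; rewrite ?pdiv_gt0. Qed.

Lemma dvdn_from_log d g : 0 < d -> 0 < g ->
  (forall r, prime r -> logn r d <= logn r g) -> d %| g.
Proof.
move=> d_gt0 g_gt0 le_log; apply/dvdn_partP => // r.
rewrite mem_primes => /and3P[r_pr _ _].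
by rewrite p_part pfactor_dvdn ?le_log.
Qed.

Lemma is_gcd_multinomial n : (exists s, Phat n s) ->
  is_gcd (Phat n) (multinomial n) (exp_mangoldt n * exp_mangoldt n.-1).
Proof.
case=> s0 /andP[/eqP sum_s0 /allP le_s0].
have [n_gt2 | n_le2] := ltnP 2 n; last first.
  have n0: n = 0.
    rewrite -sum_s0 sumnE big_seq big1 // => i /le_s0 le_i.
    by apply/eqP; rewrite -leqn0 -(leq_add2r 2) (leq_trans le_i).
  (* The empty list belongs to the family, and its coefficient is 1. *)
  rewrite n0; split=> [s _ | d dvd_d]; first by rewrite dvd1n.
  by have := dvd_d [::] isT; rewrite /multinomial big_nil.
have n_gt0: 0 < n by apply: ltn_trans n_gt2.
split=> [s /andP[/eqP sum_s le_s] | d dvd_d].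
  have lt_s: all (fun i => i < n.-1) s.
    by apply: sub_all le_s => i; rewrite addn2 -[in _ < n](prednK n_gt0) ltnS.
  rewrite Gauss_dvd; last first.
    apply: coprime_dvdl (exp_mangoldt_dvd n) _.
    exact: coprime_dvdr (exp_mangoldt_dvd n.-1) (coprimenP n_gt0).
  rewrite /exp_mangoldt; apply/andP; split; case: ifP; rewrite ?dvd1n // => p_n.
    apply: prime_dvd_multinomial p_n sum_s _; first by rewrite pdiv_prime // ltnW.
    by apply: sub_all lt_s => i /leq_trans; apply; apply: leq_pred.
  apply: prime_dvd_multinomial_pred p_n sum_s lt_s => //.
  by rewrite pdiv_prime // -ltnS prednK.
apply: dvdn_from_log; first exact: common_divisor_gt0 dvd_d.
  by rewrite muln_gt0 !exp_mangoldt_gt0.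
have n1_gt1: 1 < n.-1 by rewrite -ltnS prednK.
move=> r r_pr; rewrite lognM ?exp_mangoldt_gt0 //.
rewrite !logn_exp_mangoldt ?(ltnW n_gt2) //.
exact: logn_common_divisor.
Qed.

Theorem proposition1 (n : nat) (Phat_neq0 : exists sigma : seq nat, Phat n sigma) :
  [/\ (* (1) *)
      forall p : nat, prime_power_of p n ->
        ~ (exists q : nat, prime_power_plus1_of q n) ->
        is_gcd (Phat n) (multinomial n) p,
      (* (2) *)
      forall q : nat, prime_power_plus1_of q n ->
        ~ (exists p : nat, prime_power_of p n) ->
        is_gcd (Phat n) (multinomial n) q,
      (* (3) *)
      forall p q : nat, prime_power_of p n -> prime_power_plus1_of q n ->
        is_gcd (Phat n) (multinomial n) (p * q)
    & (* (4) *)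
      ~ (exists p : nat, prime_power_of p n) ->
      ~ (exists q : nat, prime_power_plus1_of q n) ->
        is_gcd (Phat n) (multinomial n) 1].
Proof.
have gcdP := is_gcd_multinomial Phat_neq0.
have plus1 q : prime_power_plus1_of q n -> exp_mangoldt n.-1 = q.
  move=> q_n; apply: exp_mangoldt_pow; apply/prime_power_plus1E => //.
  by case: q_n => _ [t [_ ->]]; rewrite addn1.
have nplus1 : ~ (exists q, prime_power_plus1_of q n) -> exp_mangoldt n.-1 = 1.
  case: (posnP n) => [-> // | n_gt0] no_q; apply: exp_mangoldt_npow => -[q q_n].
  by case: no_q; exists q; apply/prime_power_plus1E.
split=> [p p_n no_q | q q_n no_p | p q p_n q_n | no_p no_q].
- by rewrite -(exp_mangoldt_pow p_n) -[X in is_gcd _ _ X]muln1 -(nplus1 no_q).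
- by rewrite -(plus1 q q_n) -[X in is_gcd _ _ X]mul1n -(exp_mangoldt_npow no_p).
- by rewrite -(exp_mangoldt_pow p_n) -(plus1 q q_n).
by rewrite -[1]mul1n -{1}(exp_mangoldt_npow no_p) -(nplus1 no_q).
Qed.
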